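(* Let $G=(V,E)$ be a finite graph with maximum degree $\Delta$, let $q\in\mathbb N$ and $\beta\ge 0$. Let $P_{\rm SW}$ and $P_{\rm HB}$ be the transition matrices of the Swendsen--Wang dynamics and the heat-bath dynamics, respectively, for the $q$-state Potts model on $G$ at inverse temperature $\beta$. Then \[ \lambda(P_{\rm SW})\;\ge\; c_{\rm SW}\,\lambda(P_{\rm HB}),\qquad\text{where } c_{\rm SW}=c_{\rm SW}(\Delta,\beta,q):=q^{-1}\bigl(q\,e^{2\beta}\bigr)^{-2\Delta}. \]
   Context: Graphs are finite; parallel edges and loops are allowed; each edge $e$ has a set $\{e^{(1)},e^{(2)}\}$ of one or two endvertices. $\deg_G(v)$ is the number of edges having $v$ as an endvertex, and $\Delta=\max_v\deg_G(v)$. For $A\subseteq E$, $c(A)$ is the number of connected components of the spanning subgraph $(V,A)$. Potts model: $\Omega_{\rm P}=\{1,\dots,q\}^V$, $E(\sigma)=\{e\in E:\sigma(e^{(1)})=\sigma(e^{(2)})\}$, and $\pi(\sigma)=e^{\beta|E(\sigma)|}/Z$ with $Z$ the normalizing constant. Heat-bath dynamics: for $\sigma\in\Omega_{\rm P}$, $v\in V$, $k\in\{1,\dots,q\}$ let $\sigma^{v,k}$ agree with $\sigma$ off $v$ and equal $k$ at $v$, and $\Omega_{\sigma,v}=\{\sigma^{v,l}:l=1,\dots,q\}$. Then $P_{\rm HB}(\sigma,\tau)=\frac1{|V|}\sum_{v\in V}\frac{\pi(\tau)}{\sum_{l=1}^q\pi(\sigma^{v,l})}\mathbf 1(\tau\in\Omega_{\sigma,v})$.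 Swendsen--Wang dynamics: with $p=1-e^{-\beta}$, $P_{\rm SW}(\sigma,\tau)=(1-p)^{|E(\sigma)|}\sum_{A\subseteq E(\sigma)\cap E(\tau)}\bigl(\tfrac{p}{1-p}\bigr)^{|A|}q^{-c(A)}$ (from $\sigma$, keep each edge of $E(\sigma)$ independently with probability $p$ to obtain $A$, then give each connected component of $(V,A)$ an independent uniformly random color). Both chains are ergodic and reversible with respect to $\pi$. For such a transition matrix $P$, the spectral gap is $\lambda(P)=1-\max\{|\xi|:\xi\text{ an eigenvalue of }P,\ \xi\neq1\}$. *)

(* Defs.v *)
From HB Require Import structures.
From mathcomp Require Import all_boot all_order all_algebra.
From mathcomp Require Import classical_sets reals sequences.

Set Implicit Arguments. Unset Strict Implicit. Unset Printing Implicit Defensive.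
Import Order.TTheory GRing.Theory Num.Theory.
Local Open Scope ring_scope.

Section Potts.
Variables (R : realType) (V E : finType) (ends : E -> V * V).
(* A (multi)graph G = (V, E): edge e has endvertices (ends e).1 and (ends e).2
   (equal for a loop). *)

Definition deg (v : V) : nat :=
  #|[set e : E | ((ends e).1 == v) || ((ends e).2 == v)]|.

Definition maxdeg : nat := \max_(v : V) deg v.

Definition adjA (A : {set E}) : rel V :=
  fun x y => [exists e in A, (ends e == (x, y)) || (ends e == (y, x))].

Definition ncomp (A : {set E}) : nat :=
  #|[set [set y | connect (adjA A) x y] | x : V]|.

Variable q : nat.
Definition config := {ffun V -> 'I_q}.

Definition mono (s : config) : {set E} :=
  [set e : E | s (ends e).1 == s (ends e).2].

Variable beta : R.

Definition Zpotts : R := \sum_(s : config) expR (beta * (#|mono s|)%:R).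
Definition piP (s : config) : R := expR (beta * (#|mono s|)%:R) / Zpotts.

Definition recolor (s : config) (v : V) (k : 'I_q) : config :=
  [ffun u => if u == v then k else s u].

Definition in_fiber (s : config) (v : V) (t : config) : bool :=
  [forall u, (u != v) ==> (t u == s u)].

Definition P_HB (s t : config) : R :=
  (#|V|%:R)^-1 * \sum_(v : V)
     (piP t / (\sum_(l : 'I_q) piP (recolor s v l))) * (in_fiber s v t)%:R.

Definition pSW : R := 1 - expR (- beta).

Definition P_SW (s t : config) : R :=
  (1 - pSW) ^+ #|mono s| *
  \sum_(A : {set E} | A \subset mono s :&: mono t)
     (pSW / (1 - pSW)) ^+ #|A| * ((q%:R) ^+ ncomp A)^-1.

Definition kmx (P : config -> config -> R) : 'M[R]_#|{: config}| :=
  \matrix_(i, j) P (enum_val i) (enum_val j).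

End Potts.

Local Open Scope classical_set_scope.
(* spectral gap: 1 - max{|xi| : xi eigenvalue of P, xi <> 1}
   (the max over the empty set is taken to be 0). *)
Definition spectral_gap (R : realType) (n : nat) (M : 'M[R]_n) : R :=
  1 - sup [set `|x| | x in [set x : R | eigenvalue M x && (x != 1)]].

Definition c_SW (R : realType) (Delta : nat) (beta : R) (q : nat) : R :=
  (q%:R)^-1 * ((q%:R * expR (2 * beta)) ^+ (2 * Delta))^-1.

Arguments P_HB {R V E} ends q beta s t.
Arguments P_SW {R V E} ends q beta s t.
Arguments kmx {R V q} P.
Arguments piP {R V E} ends q beta s.
Arguments Zpotts {R V E} ends q beta.

(* Main.v *)
(* The heat-bath kernel Q and the Swendsen-Wang kernel P satisfy
   [c_SW * (Q P Q) <= P] entrywise: one-site changes of the two arguments of P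
   affect at most 2 Delta edges, each of which costs at most a factor
   [q e^beta] in the sum over edge sets A (deleting an edge creates at most one
   new component) and a factor [e^beta] in [(1 - p)^|E(sigma)|], while the
   column sums of Q are at most q. By reversibility this compares the Dirichlet
   forms of P and Q P Q. Since P is a contraction, the latter has gap at least
   [1 - mu^2 >= 1 - mu], with [mu = 1 - lambda(Q)]; since P is positive
   semidefinite, its gap is read off its Dirichlet form. *)
Require Import Defs.
From HB Require Import structures.
From mathcomp Require Import all_boot all_order all_algebra.
From mathcomp Require Import sesquilinear spectral complex ring lra.
From mathcomp Require Import boolp classical_sets reals sequences exp.
(* [classical_sets] shadows finite-set names such as [set0] and [subsetP]. *)
From mathcomp Require Import fintype finset.
Import Order.TTheory GRing.Theory Num.Theory.
Local Open Scope ring_scope.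
Local Open Scope sesquilinear_scope.

(** * Symmetric matrices with a positive fixed vector *)

Section SymmetricMatrices.
Context {R : rcfType} {n : nat}.
Implicit Types (A B : 'M[R]_n) (u x y : 'rV[R]_n).

(** Expand the square on the right: since [u] is fixed by the symmetric matrix [A], each of the two
    square terms sums to the squared norm of [x], and the cross term is the quadratic form. Dividing
    by [u] plays the role of passing to functions on the states of a reversible chain with
    stationary weights [u ^+ 2]. *)
Lemma dirichlet_formE A u x :
  A^T = A -> u *m A = u -> (forall i, 0 < u 0 i) ->
  \sum_i x 0 i ^+ 2 - \sum_i \sum_j x 0 i * A i j * x 0 j =
  2^-1 * \sum_i \sum_j A i j * u 0 i * u 0 j * (x 0 i / u 0 i - x 0 j / u 0 j) ^+ 2.
Proof.
move=> symA uA u_gt0.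
have u_neq0 i : u 0 i != 0 by rewrite gt_eqF.
have Au j : \sum_i u 0 i * A i j = u 0 j by rewrite -{2}uA mxE.
have Ac i j : A i j = A j i by rewrite -{1}symA mxE.
have sq1 : \sum_i \sum_j A i j * u 0 i * x 0 j ^+ 2 / u 0 j = \sum_i x 0 i ^+ 2.
  rewrite exchange_big /=; apply: eq_bigr => j _.
  transitivity (\sum_i (u 0 i * A i j) * (x 0 j ^+ 2 / u 0 j)).
    by apply: eq_bigr => i _; ring.
  by rewrite -mulr_suml Au mulrCA divff// mulr1.
have sq2 : \sum_i \sum_j A i j * u 0 j * x 0 i ^+ 2 / u 0 i = \sum_i x 0 i ^+ 2.
  rewrite -sq1 exchange_big /=; apply: eq_bigr => j _; apply: eq_bigr => i _.
  by rewrite Ac.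
have -> : \sum_i \sum_j A i j * u 0 i * u 0 j * (x 0 i / u 0 i - x 0 j / u 0 j) ^+ 2
  = \sum_i \sum_j A i j * u 0 j * x 0 i ^+ 2 / u 0 i
  + \sum_i \sum_j A i j * u 0 i * x 0 j ^+ 2 / u 0 j
  - 2 * \sum_i \sum_j x 0 i * A i j * x 0 j.
  rewrite mulr_sumr -sumrN -!big_split /=; apply: eq_bigr => i _.
  rewrite mulr_sumr -sumrN -!big_split /=; apply: eq_bigr => j _.
  by field; rewrite !u_neq0.
by rewrite sq1 sq2; lra.
Qed.

(** A nonnegative matrix fixing [u] does not increase the l1 norm weighted by [u]; apply this to an
    eigenvector. *)
Lemma eigenvalue_norm_le1 A u a :
  A^T = A -> u *m A = u -> (forall i, 0 < u 0 i) -> (forall i j, 0 <= A i j) ->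
  eigenvalue A a -> `|a| <= 1.
Proof.
move=> symA uA u_gt0 A_ge0 /eigenvalueP[v vA vN0].
have Au i : \sum_j A i j * u 0 j = u 0 i.
  rewrite -{2}uA mxE; apply: eq_bigr => j _; rewrite mulrC.
  by congr (_ * _); rewrite -{1}symA mxE.
have S_gt0 : 0 < \sum_i `|v 0 i| * u 0 i.
  have [i vi] : exists i, v 0 i != 0 by apply/rV0Pn.
  rewrite (bigD1 i)//= ltr_pwDl ?mulr_gt0 ?normr_gt0//.
  by apply: sumr_ge0 => j _; rewrite mulr_ge0// ltW.
rewrite -(ler_pM2r S_gt0) mul1r mulr_sumr.
apply: (@le_trans _ _ (\sum_j \sum_i `|v 0 i| * A i j * u 0 j)).
  apply: ler_sum => j _; rewrite mulrA -normrM.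
  have -> : a * v 0 j = \sum_i v 0 i * A i j.
    by move/rowP: vA => /(_ j); rewrite !mxE => <-.
  rewrite -mulr_suml ler_wpM2r ?(ltW (u_gt0 _))//.
  apply: (le_trans (ler_norm_sum _ _ _)); apply: ler_sum => i _.
  by rewrite normrM (ger0_norm (A_ge0 _ _)).
rewrite exchange_big /=; apply: ler_sum => i _.
rewrite -[u 0 i in leRHS]Au mulr_sumr.
by apply: ler_sum => j _; rewrite mulrA.
Qed.

(* Connectivity forces the eigenvalue 1 to be simple: the Dirichlet form of a
   fixed vector vanishes. *)
Lemma fixed_row_proportional A u x :
  A^T = A -> u *m A = u -> (forall i, 0 < u 0 i) -> (forall i j, 0 <= A i j) ->
  (forall i j, connect (fun i j => 0 < A i j) i j) ->
  x *m A = x -> exists a, x = a *: u.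
Proof.
move=> symA uA u_gt0 A_ge0 Aconn xA.
have := dirichlet_formE A u x symA uA u_gt0.
have -> : \sum_i \sum_j x 0 i * A i j * x 0 j = \sum_j x 0 j ^+ 2.
  rewrite exchange_big /=; apply: eq_bigr => j _.
  by rewrite -mulr_suml -[in RHS]xA expr2 {2}xA [in RHS]mxE.
rewrite subrr => /esym/eqP; rewrite mulf_eq0 invr_eq0 pnatr_eq0 /=.
have term_ge0 i j :
  0 <= A i j * u 0 i * u 0 j * (x 0 i / u 0 i - x 0 j / u 0 j) ^+ 2.
  by rewrite mulr_ge0 ?sqr_ge0// !mulr_ge0 ?(ltW (u_gt0 _)).
rewrite psumr_eq0 => [/allP D0|i _]; last exact: sumr_ge0.
(* A vanishing sum of nonnegative terms has only zero terms, so the ratio [x / u] agrees across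
   every positive entry of [A]. *)
have step i j : 0 < A i j -> x 0 i / u 0 i = x 0 j / u 0 j.
  move=> Aij; have := D0 i (mem_index_enum i); rewrite /= psumr_eq0//.
  move=> /allP/(_ j (mem_index_enum j)) /=.
  rewrite mulf_eq0 sqrf_eq0 subr_eq0 !mulf_eq0 (gt_eqF Aij) !(gt_eqF (u_gt0 _)).
  by move=> /eqP.
have all_eq i j : x 0 i / u 0 i = x 0 j / u 0 j.
  have /connectP[p] := Aconn i j; elim: p i => [|k p IHp] i /=.
    by move=> _ ->.
  by move=> /andP[/step -> pkp] /(IHp k pkp).
(* For [n = 0] there is no index at which to read the ratio, and any scalar works. *)
case: (pickP (fun i : 'I_n => true)) => [i0 _|no].
  exists (x 0 i0 / u 0 i0); apply/rowP => j; rewrite !mxE (all_eq i0 j).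
  by rewrite divfK// gt_eqF.
by exists 0; apply/rowP => j; have := no j.
Qed.

(** The complexification [Bc] is hermitian, hence diagonal in a unitary basis. Unitary matrices
    preserve the norm [N], and the diagonal entries are real eigenvalues of [B], hence of modulus at
    most [mu]. *)
Lemma sum_sqr_mulmx_le B mu x :
  B^T = B -> (forall a, eigenvalue B a -> `|a| <= mu) ->
  \sum_i (x *m B) 0 i ^+ 2 <= mu ^+ 2 * \sum_i x 0 i ^+ 2.
Proof.
move=> symB mu_max; pose toC := real_complex R.
pose Bc := map_mx toC B; pose S := spectralmx Bc; pose d := spectral_diag Bc.
have realC (r : R) : toC r \is Num.real by apply/complex_realP; exists r.
have Bc_real : Bc \is a mxOver Num.real by apply/mxOverP => i j; rewrite mxE realC.
have Bc_herm : Bc \is hermsymmx.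
  apply: realsym_hermsym Bc_real; apply/is_hermitianmxP.
  by rewrite expr0 scale1r map_mx_id// map_trmx symB.
have S_unitary : S \is unitarymx by apply: spectral_unitarymx.
have BcE : Bc = S^t* *m diag_mx d *m S.
  by rewrite -invmx_unitary//; apply/orthomx_spectralP/hermitian_normalmx.
have SSt : S *m S^t* = 1%:M by apply/unitarymxP.
pose N (z : 'rV[R[i]]_n) := \sum_i `|z 0 i| ^+ 2.
have NE z : N z = (z *m z^t*) 0 0.
  by rewrite mxE; apply: eq_bigr => i _; rewrite !mxE normCK.
have NS z : N (z *m S) = N z.
  by rewrite !NE trmx_mul map_mxM !mulmxA -[z *m S *m _]mulmxA SSt mulmx1.
have NC (z : 'rV[R]_n) : N (map_mx toC z) = toC (\sum_i z 0 i ^+ 2).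
  rewrite /toC rmorph_sum; apply: eq_bigr => i _.
  by rewrite mxE real_normK// rmorphXn.
have d_le i : `|d 0 i| <= toC mu.
  have /complex_realP[r dr] : d 0 i \is Num.real.
    exact/mxOverP/hermitian_spectral_diag_real.
  have : eigenvalue Bc (toC r).
    (* The rows of [S] are left eigenvectors of [Bc]; they are nonzero because [S] is unitary. *)
    apply/eigenvalueP; exists (row i S).
      rewrite -row_mul BcE !mulmxA SSt mul1mx; apply/rowP => j.
      by rewrite !mxE (bigD1 i)//= big1 => [|k /negPf ki];
        rewrite !mxE ?eqxx ?addr0 ?dr// eq_sym ki mul0r.
    apply: contra_neq (oner_neq0 R[i]) => Si0.
    have /matrixP/(_ i i) := SSt; rewrite !mxE eqxx => SSti.
    apply: etrans (esym SSti) _.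
    by apply: big1 => j _; move/rowP: Si0 => /(_ j); rewrite !mxE => ->; rewrite mul0r.
  rewrite eigenvalue_map => /mu_max; rewrite -lecR dr; congr (_ <= _).
  by rewrite normc_def /= expr0n addr0 sqrtr_sqr.
suff : N (map_mx toC (x *m B)) <= toC (mu ^+ 2) * N (map_mx toC x).
  by rewrite !NC -rmorphM lecR.
rewrite map_mxM -/Bc; set z := map_mx toC x.
have -> : z *m Bc = z *m S^t* *m diag_mx d *m S by rewrite BcE !mulmxA.
have -> : N z = N (z *m S^t*).
  rewrite -[RHS]NS -mulmxA.
  by have /mulmx1C -> := SSt; rewrite mulmx1.
rewrite NS mulr_sumr; apply: ler_sum => i _.
rewrite mul_mx_diag mxE normrM exprMn mulrC ler_wpM2r ?exprn_ge0//.
by rewrite /toC rmorphXn lerXn2r ?nnegrE ?normr_ge0// (le_trans _ (d_le i)).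
Qed.

(* Subtracting the projection on u removes the eigenvalue 1, which is simple. *)
Lemma sum_sqr_mulmx_le_orthogonal B u mu x :
  B^T = B -> u *m B = u -> (forall i, 0 < u 0 i) ->
  (forall y, y *m B = y -> exists a, y = a *: u) -> 0 <= mu ->
  (forall a, eigenvalue B a -> a != 1 -> `|a| <= mu) ->
  x *m u^T = 0 ->
  \sum_i (x *m B) 0 i ^+ 2 <= mu ^+ 2 * \sum_i x 0 i ^+ 2.
Proof.
move=> symB uB u_gt0 simple1 mu_ge0 mu_max xu.
pose s := (u *m u^T) 0 0; pose B' := B - s^-1 *: (u^T *m u).
have uus : u *m u^T = s%:M by rewrite [LHS]mx11_scalar.
have symB' : B'^T = B'.
  by rewrite /B' linearB/= linearZ/= trmx_mul trmxK symB.
have B'E y : y *m u^T = 0 -> y *m B' = y *m B.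
  by move=> yu; rewrite mulmxBr -scalemxAr mulmxA yu mul0mx scaler0 subr0.
(* It remains to bound the eigenvalues of [B']. For a nonzero one, the eigenvector is orthogonal to
   [u] because [B'] kills [u], so it is an eigenvector of [B] too; the eigenvalue 1 would make it a
   multiple of [u], hence zero. *)
rewrite -B'E//; apply: sum_sqr_mulmx_le => // a /eigenvalueP[y yB' yN0].
have [->|aN0] := eqVneq a 0; first by rewrite normr0.
have s_neq0 : s != 0.
  have [i _] : exists i, y 0 i != 0 by apply/rV0Pn.
  rewrite gt_eqF// /s mxE (bigD1 i)//= ltr_pwDl ?mxE ?mulr_gt0//.
  by apply: sumr_ge0 => j _; rewrite mxE mulr_ge0// ltW.
have uB' : u *m B' = 0.
  rewrite mulmxBr uB -scalemxAr mulmxA uus mul_scalar_mx scalerA mulVf//.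
  by rewrite scale1r subrr.
have yu : y *m u^T = 0.
  apply: (scalerI aN0); rewrite scaler0 scalemxAl -yB' -mulmxA.
  by rewrite -{1}symB' -trmx_mul uB' trmx0 mulmx0.
have yB : y *m B = a *: y by rewrite -B'E.
apply: mu_max; first by apply/eigenvalueP; exists y.
apply: contra_neq yN0 => a1; rewrite a1 scale1r in yB.
have [b yb] := simple1 y yB; move: yu.
rewrite yb -scalemxAl uus => /matrixP/(_ 0 0)/eqP.
by rewrite !mxE eqxx mulr1n mulf_eq0 (negPf s_neq0) orbF => /eqP->; rewrite scale0r.
Qed.

End SymmetricMatrices.

(** * Comparison of spectral gaps, first for symmetric matrices, then for reversible kernels *)

Section SpectralGapComparison.
Context {R : realType} {n : nat}.
Implicit Types (A B P Q : 'M[R]_n).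

(* For [x] orthogonal to [u], [x (B A B) x^T <= |x B|^2 <= mu^2 |x|^2], where
   [mu] is the largest modulus of an eigenvalue [!= 1] of [B]; so the Dirichlet form of
   [B A B] at [x] is at least [(1 - mu^2) |x|^2 >= (1 - mu) |x|^2]. *)
Lemma symmetric_spectral_gap_le A B (u : 'rV[R]_n) (c : R) :
  A^T = A -> B^T = B -> u *m A = u -> u *m B = u -> (forall i, 0 < u 0 i) ->
  (forall i j, 0 <= A i j) -> (forall i j, 0 <= B i j) ->
  (forall i j, connect (fun i j => 0 < B i j) i j) ->
  (forall x : 'rV_n, 0 <= \sum_i \sum_j x 0 i * A i j * x 0 j) ->
  0 <= c <= 1 -> (forall i j, c * (B *m A *m B) i j <= A i j) ->
  c * spectral_gap B <= spectral_gap A.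
Proof.
move=> symA symB uA uB u_gt0 A_ge0 B_ge0 Bconn A_psd /andP[c_ge0 c_le1] cBAB.
set mu := sup [set `|a| | a in [set a : R | eigenvalue B a && (a != 1)]]%classic.
rewrite /spectral_gap -/mu.
(* [sup] is an upper bound only of a bounded set; the bound is 1. *)
have mu_ub a : eigenvalue B a -> a != 1 -> `|a| <= mu.
  move=> Ba a1; apply: ub_le_sup; last by exists a => //=; apply/andP.
  exists 1 => _ [b /= /andP[Bb _] <-].
  exact: (eigenvalue_norm_le1 B u).
have mu_le1 : 0 <= mu <= 1.
  have [[_ [a /= /andP[Ba a1] _]]|empty] :=
    pselect ([set `|a| | a in [set a : R | eigenvalue B a && (a != 1)]] !=set0)%classic.
    rewrite (le_trans (normr_ge0 a) (mu_ub a Ba a1))/=.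
    apply: ge_sup; first by exists `|a|, a => //=; apply/andP.
    by move=> _ [b /= /andP[Bb _] <-]; apply: (eigenvalue_norm_le1 B u).
  (* With no eigenvalue other than 1, [sup] takes its default value 0. *)
  by rewrite /mu sup_out ?lexx ?ler01// => -[].
case/andP: mu_le1 => mu_ge0 mu_le1.
suff A_le a : eigenvalue A a -> a != 1 -> `|a| <= 1 - c * (1 - mu).
  rewrite lerBrDr -lerBrDl.
  have [ne|empty] := pselect
    ([set `|a| | a in [set a : R | eigenvalue A a && (a != 1)]] !=set0)%classic.
    by apply: ge_sup => // _ [a /= /andP[Aa a1] <-]; apply: A_le.
  rewrite sup_out => [|[]//]; rewrite subr_ge0 mulr_ile1//; lra.
move=> /eigenvalueP[x xA xN0] a1.
(* Eigenvectors of a symmetric matrix for the distinct eigenvalues [a] and 1 are orthogonal. *)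
have xu : x *m u^T = 0.
  have : a *: (x *m u^T) = x *m u^T.
    by rewrite scalemxAl -xA -mulmxA -{1}symA -trmx_mul uA.
  move/eqP; rewrite -subr_eq0 -{2}[x *m u^T]scale1r -scalerBl scaler_eq0.
  by rewrite subr_eq0 (negPf a1) => /eqP.
pose N (z : 'rV[R]_n) := \sum_i z 0 i ^+ 2.
pose qf (K : 'M[R]_n) (z : 'rV[R]_n) := \sum_i \sum_j z 0 i * K i j * z 0 j.
have qfE K z : qf K z = (z *m K *m z^T) 0 0.
  rewrite /qf exchange_big mxE; apply: eq_bigr => j _ /=.
  by rewrite !mxE mulr_suml.
have N_gt0 : 0 < N x.
  have [i xi] : exists i, x 0 i != 0 by apply/rV0Pn.
  rewrite /N (bigD1 i)//= ltr_pwDl ?exprn_even_gt0//.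
  by apply: sumr_ge0 => j _; rewrite sqr_ge0.
have qfA : qf A x = a * N x.
  by rewrite qfE xA -scalemxAl mxE mxE; congr (_ * _); apply: eq_bigr => i _;
    rewrite mxE expr2.
have dirA z : qf A z <= N z.
  rewrite -subr_ge0 (dirichlet_formE A u)// mulr_ge0 ?invr_ge0//.
  by apply: sumr_ge0 => i _; apply: sumr_ge0 => j _;
    rewrite mulr_ge0 ?sqr_ge0// !mulr_ge0 ?(ltW (u_gt0 _)).
(* [B *m A *m B] is again symmetric and fixes [u], so both sides are sums of the same squares, with
   coefficients compared entrywise by [cBAB]. *)
have dirBAB : c * (N x - qf (B *m A *m B) x) <= N x - qf A x.
  rewrite !(dirichlet_formE _ u)//; last 2 first.
  - by rewrite !trmx_mul symA symB mulmxA.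
  - by rewrite !mulmxA uB uA uB.
  rewrite mulrCA ler_wpM2l ?invr_ge0// mulr_sumr; apply: ler_sum => i _.
  rewrite mulr_sumr; apply: ler_sum => j _.
  by rewrite mulrA ler_wpM2r ?sqr_ge0// 2!mulrA !ler_wpM2r ?(ltW (u_gt0 _)).
have qfBAB : qf (B *m A *m B) x = qf A (x *m B).
  by rewrite !qfE trmx_mul symB !mulmxA.
have NB : N (x *m B) <= mu ^+ 2 * N x.
  apply: (sum_sqr_mulmx_le_orthogonal B u) => //.
  by move=> y; apply: fixed_row_proportional.
(* Positive semidefiniteness excludes negative eigenvalues, which the Dirichlet form does not
   control in modulus. *)
have a_ge0 : 0 <= a by rewrite -(pmulr_lge0 _ N_gt0) -qfA A_psd.
rewrite ger0_norm// -(ler_pM2r N_gt0).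
have qfBAB_le : qf (B *m A *m B) x <= mu * N x.
  rewrite qfBAB (le_trans (dirA _))// (le_trans NB)// ler_wpM2r ?(ltW N_gt0)//.
  by rewrite expr2 ler_piMr.
have : c * (N x - mu * N x) <= N x - a * N x.
  by rewrite -qfA (le_trans _ dirBAB)// ler_wpM2l// lerB.
by move=> H; rewrite mulrBl -mulrA mulrBl !mul1r; lra.
Qed.

Lemma spectral_gap_similar A P (D D' : 'M[R]_n) :
  D *m D' = 1%:M -> A = D *m P *m D' -> spectral_gap A = spectral_gap P.
Proof.
move=> DD' AE; have D'D : D' *m D = 1%:M by apply: mulmx1C.
have sub (M M' C C' : 'M[R]_n) a : C *m C' = 1%:M -> C' *m C = 1%:M ->
    M = C *m M' *m C' -> eigenvalue M a -> eigenvalue M' a.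
  move=> CC' C'C ME /eigenvalueP[v vM vN0]; apply/eigenvalueP.
  exists (v *m C).
    by rewrite scalemxAl -vM ME !mulmxA -(mulmxA _ C' C) C'C mulmx1.
  apply: contra_neq vN0 => vC0.
  by rewrite -[v]mulmx1 -CC' mulmxA vC0 mul0mx.
rewrite /spectral_gap; congr (1 - sup _); congr ([set _ | _ in _]%classic).
apply/seteqP; split=> a /= /andP[ev a1]; rewrite a1 andbT.
  exact: (sub A P D D').
by apply: (sub P A D' D) => //; rewrite AE !mulmxA D'D mul1mx -mulmxA D'D mulmx1.
Qed.

(** Conjugation by the diagonal matrix of the square roots of [w] makes reversible kernels
    symmetric, turns their row sums into the fixed vector [u], and preserves spectra, products,
    signs and entrywise inequalities. *)
Lemma reversible_spectral_gap_le P Q (w : 'I_n -> R) (c : R) :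
  (forall i, 0 < w i) ->
  (forall i j, w i * P i j = w j * P j i) ->
  (forall i j, w i * Q i j = w j * Q j i) ->
  (forall i, \sum_j P i j = 1) -> (forall i, \sum_j Q i j = 1) ->
  (forall i j, 0 <= P i j) -> (forall i j, 0 <= Q i j) ->
  (forall i j, connect (fun i j => 0 < Q i j) i j) ->
  (forall x : 'I_n -> R, 0 <= \sum_i \sum_j w i * P i j * x i * x j) ->
  0 <= c <= 1 -> (forall i j, c * (Q *m P *m Q) i j <= P i j) ->
  c * spectral_gap Q <= spectral_gap P.
Proof.
move=> w_gt0 revP revQ P1 Q1 P_ge0 Q_ge0 Qconn P_psd c01 cQPQ.
pose s i := Num.sqrt (w i).
have s_gt0 i : 0 < s i by rewrite sqrtr_gt0.
have s_neq0 i : s i != 0 by rewrite gt_eqF.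
have s2 i : s i * s i = w i by rewrite -expr2 sqr_sqrtr// ltW.
pose u : 'rV[R]_n := \row_i s i.
pose D := diag_mx u; pose D' := diag_mx (\row_i (s i)^-1).
have DD' : D *m D' = 1%:M.
  rewrite mulmx_diag; apply/matrixP => i j; rewrite !mxE.
  by rewrite divff// -mulrb; case: (i == j).
have D'D : D' *m D = 1%:M by apply: mulmx1C.
pose sym (M : 'M[R]_n) := D *m M *m D'.
have symE M i j : sym M i j = s i * M i j / s j.
  by rewrite /sym mul_mx_diag mxE mul_diag_mx !mxE.
have sym_tr (M : 'M[R]_n) : (forall i j, w i * M i j = w j * M j i) -> (sym M)^T = sym M.
  move=> revM; apply/matrixP => i j; rewrite mxE !symE.
  apply/eqP; rewrite eqr_div// -(inj_eq (mulIf (s_neq0 i))).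
  have := revM i j; rewrite -!s2 => revMij; apply/eqP.
  transitivity (s i * (s j * s j * M j i)); first by ring.
  by rewrite -revMij; ring.
have sym_u (M : 'M[R]_n) : (forall i j, w i * M i j = w j * M j i) ->
    (forall i, \sum_j M i j = 1) -> u *m sym M = u.
  move=> revM M1; rewrite -[sym M]sym_tr//; apply/rowP => i; rewrite !mxE.
  rewrite -[RHS]mulr1 -(M1 i) mulr_sumr; apply: eq_bigr => j _.
  by rewrite mxE mxE symE mulrC divfK.
rewrite -(spectral_gap_similar (sym P) P D D')//.
rewrite -(spectral_gap_similar (sym Q) Q D D')//.
have sym_ge0 (M : 'M[R]_n) : (forall i j, 0 <= M i j) -> forall i j, 0 <= sym M i j.
  by move=> M_ge0 i j; rewrite symE divr_ge0 ?mulr_ge0// ltW.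
apply: (symmetric_spectral_gap_le _ _ u) => //; rewrite ?sym_tr ?sym_u//.
- by move=> i; rewrite mxE.
- exact: sym_ge0.
- exact: sym_ge0.
- move=> i j; have := Qconn i j; congr is_true; apply: eq_connect => k l.
  by rewrite symE pmulr_lgt0 ?invr_gt0// pmulr_rgt0.
- move=> x; have := P_psd (fun i => x 0 i / s i); congr (0 <= _).
  apply: eq_bigr => i _; apply: eq_bigr => j _; rewrite symE -s2.
  by field; rewrite !s_neq0.
- move=> i j; have -> : sym Q *m sym P *m sym Q = sym (Q *m P *m Q).
    by rewrite /sym -!mulmxA !(mulmxA D' D) D'D !mul1mx.
  rewrite !symE !mulrA ler_wpM2r ?invr_ge0 ?(ltW (s_gt0 _))//.
  by rewrite (mulrC c) -mulrA ler_wpM2l ?(ltW (s_gt0 _)).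
Qed.

End SpectralGapComparison.

(** * Connected components and weighted sums over edge sets *)

Section Components.
Context {V E : finType} (ends : E -> V * V).
Implicit Types (A X Y : {set E}).

Local Notation conn A := (connect (adjA ends A)).

Lemma adjA_sym A : symmetric (adjA ends A).
Proof.
by move=> x y; apply/existsP/existsP => -[e /andP[eA exy]]; exists e;
  rewrite eA orbC.
Qed.

Lemma connA_sym A : connect_sym (adjA ends A).
Proof. exact/sym_connect_sym/adjA_sym. Qed.

Definition component A x := [set y | conn A x y].

Lemma component_eq A x y : (component A x == component A y) = conn A x y.
Proof.
apply/eqP/idP => [/setP/(_ y)|xy].
  by rewrite !inE connect0.
by apply/setP => z; rewrite !inE; apply: (same_connect (connA_sym A)).
Qed.

Lemma connA_subset A X x y : A \subset X -> conn A x y -> conn X x y.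
Proof.
move=> AX; apply: connect_sub => {}x {}y /existsP[e /andP[eA exy]].
by apply/connect1/existsP; exists e; rewrite (subsetP AX).
Qed.

(** Induction on the path: if it uses [e], then both of its ends are joined within [A] to
    endvertices of [e]. *)
Lemma connA_setU1 A e x y : conn (e |: A) x y ->
  conn A x y || (conn A (ends e).1 x || conn A (ends e).2 x)
             && (conn A (ends e).1 y || conn A (ends e).2 y).
Proof.
pose near z := conn A (ends e).1 z || conn A (ends e).2 z.
rewrite -/(near x) -/(near y); case/connectP=> p; elim: p x => [|z p IHp] x /=.
  by move=> _ ->; rewrite connect0.
move=> /andP[/existsP[e' /andP[]]]; rewrite !inE => e'A exz zp.
move=> /(IHp z zp); case/orP: e'A => [/eqP ee|e'A].
  have nx : near x.
    by rewrite /near -ee; case/orP: exz => /eqP->; rewrite /= connect0 ?orbT.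
  have nz : near z.
    by rewrite /near -ee; case/orP: exz => /eqP->; rewrite /= connect0 ?orbT.
  rewrite nx; case/orP => [zy|/andP[_ ->]]; last by rewrite orbT.
  rewrite (_ : near y) ?orbT//; case/orP: nz => nz; apply/orP; [left|right];
  exact: connect_trans nz zy.
have xz : conn A x z by apply/connect1/existsP; exists e'; rewrite e'A.
case/orP => [zy|/andP[nz ->]]; first by rewrite (connect_trans xz zy).
rewrite (_ : near x) ?orbT//; rewrite connA_sym in xz.
by case/orP: nz => nz; apply/orP; [left|right]; exact: connect_trans nz xz.
Qed.

(** Adding [e] can merge only the components of its endvertices. Hence the map [f], from a component
    of [A] to the larger one containing it, is injective once the component of [b] is set aside;
    that one accounts for the successor. *)
Lemma ncomp_setU1 A e : (ncomp ends A <= (ncomp ends (e |: A)).+1)%N.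
Proof.
pose b := (ends e).2; rewrite /ncomp.
set C := [set [set y | conn A x y] | x : V].
set C' := [set [set y | conn (e |: A) x y] | x : V].
rewrite (cardsD1 (component A b) C) -add1n leq_add ?leq_b1//.
pose f (Y : {set V}) := \bigcup_(x in Y) component (e |: A) x.
have fE x : f (component A x) = component (e |: A) x.
  apply/setP => z; apply/bigcupP/idP => [[y]|xz].
    rewrite !inE => /(connA_subset _ _ _ _ (subsetUr [set e] A)).
    exact: connect_trans.
  by exists x => //; rewrite inE connect0.
rewrite -(card_in_imset (f := f)).
  apply/subset_leq_card/subsetP => _ /imsetP[_ /setD1P[_ /imsetP[x _ ->]] ->].
  by rewrite fE; apply: imset_f.
move=> Y Z /setD1P[xb /imsetP[x _ Yx]] /setD1P[yb /imsetP[y _ Zy]] /eqP.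
rewrite {}Yx {}Zy in xb yb *.
rewrite !fE component_eq; rewrite !component_eq in xb yb.
move/connA_setU1; rewrite -/b.
rewrite (connA_sym _ x) (connA_sym _ y) in xb yb.
rewrite (negPf xb) (negPf yb) !orbF => xy; apply/eqP.
rewrite component_eq; case/orP: xy => // /andP[ax]; apply: connect_trans.
by rewrite connA_sym.
Qed.

(** Such colorings are exactly those constant on components, so [paint] is a bijection onto them
    from the colorings of the set of components. *)
Lemma card_monochromatic q A :
  #|[set t : config V q | A \subset mono ends t]| = (q ^ ncomp ends A)%N.
Proof.
pose C := [set component A x | x : V].
have inC x : component A x \in C by apply: imset_f.
pose paint (g : {ffun {Z | Z \in C} -> 'I_q}) : config V q :=
  [ffun x => g (exist _ (component A x) (inC x))].
have paint_inj : injective paint.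
  move=> g h /ffunP gh; apply/ffunP => -[Y YC]; have /imsetP[x _ Yx] := YC.
  have := gh x; rewrite !ffunE.
  suff -> : @exist _ (fun Z : {set V} => Z \in C) Y YC =
    exist _ (component A x) (inC x) by [].
  exact: val_inj.
rewrite -[RHS]/(q ^ #|C|)%N.
have -> : (q ^ #|C| = #|{ffun {Z | Z \in C} -> 'I_q}|)%N.
  by rewrite card_ffun card_ord card_sig.
rewrite -cardsT -(card_imset _ paint_inj); congr (#|pred_of_set _|).
apply/setP => t; rewrite inE; apply/subsetP/imsetP => [At|[g _ ->] e eA].
  have t_conn x y : conn A x y -> t x = t y.
    case/connectP => p; elim: p x => [|z p IHp] x /=; first by move=> _ ->.
    move=> /andP[/existsP[e /andP[/At]]]; rewrite inE => /eqP te exz zp.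
    move=> /(IHp z zp) <-.
    by case/orP: exz => /eqP ee; rewrite ee in te.
  (* A chosen vertex of each component, from which its color is read. *)
  have root_in (Y : {Z | Z \in C}) : {x | val Y = component A x}.
    by case: Y => Y YC; apply: sig_eqW; have /imsetP[x _ Yx] := YC; exists x.
  exists [ffun Y => t (sval (root_in Y))] => //; apply/ffunP => x.
  rewrite !ffunE; case: (root_in _) => y /= /eqP; rewrite component_eq.
  exact: t_conn.
rewrite inE !ffunE; apply/eqP; congr (g _); apply/val_inj/eqP => /=.
rewrite component_eq; apply/connect1/existsP; exists e.
by rewrite eA -surjective_pairing eqxx.
Qed.

Lemma sum_subset_setD1 (M : nmodType) X e (f : {set E} -> M) : e \in X ->
  \sum_(A : {set E} | A \subset X) f A =
  \sum_(A : {set E} | A \subset X :\ e) (f A + f (e |: A)).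
Proof.
move=> eX; rewrite big_split /= (bigID (fun A : {set E} => e \in A)) /= addrC.
congr (_ + _); first by apply: eq_bigl => A; rewrite subsetD1.
rewrite (reindex_onto (fun A => e |: A) (fun A => A :\ e)) /=.
  apply: eq_bigl => A; rewrite setU11 andbT subUset sub1set eX subsetD1 /=.
  congr (_ && _); apply/eqP/idP => [<-|eA]; first by rewrite !inE eqxx.
  exact: setU1K.
by move=> A /andP[_ eA]; rewrite setD1K.
Qed.

Context {R : realFieldType}.
Implicit Types w : R.

Lemma sum_subset_exp w X : \sum_(A : {set E} | A \subset X) w ^+ #|A| = (1 + w) ^+ #|X|.
Proof.
elim: {X}#|X| {-2}X (erefl #|X|) => [|m IHm] X cX.
  rewrite (cards0_eq cX) (big_pred1 set0) => [|A]; last by rewrite subset0.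
  by rewrite cards0.
have [e eX] : exists e, e \in X by apply/set0Pn; rewrite -card_gt0 cX.
have cXe : #|X :\ e| = m by move: cX; rewrite (cardsD1 e) eX => -[].
rewrite (sum_subset_setD1 _ _ e)// cX exprS -cXe -(IHm _ cXe) mulr_sumr.
apply: eq_bigr => A; rewrite subsetD1 => /andP[_ eA].
by rewrite cardsU1 eA /= add1n exprS mulrDl mul1r.
Qed.

(** The edge-set sum in the Swendsen--Wang kernel, with [w] the odds of keeping an edge; an
    arbitrary [X] allows edges to be removed one at a time. *)
Definition fk_sum w q X : R :=
  \sum_(A : {set E} | A \subset X) w ^+ #|A| * (q%:R ^+ ncomp ends A)^-1.

Lemma fk_sum_ge0 w q X : 0 <= w -> 0 <= fk_sum w q X.
Proof.
move=> w0; apply: sumr_ge0 => A _.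
by rewrite mulr_ge0 ?exprn_ge0// invr_ge0 exprn_ge0.
Qed.

Lemma fk_sum_subset w q X Y : 0 <= w -> X \subset Y -> fk_sum w q X <= fk_sum w q Y.
Proof.
move=> w0 XY; rewrite /fk_sum [leRHS](bigID (fun A : {set E} => A \subset X)) /=.
rewrite [X in X + _](_ : _ = fk_sum w q X).
  rewrite lerDl; apply: sumr_ge0 => A _.
  by rewrite mulr_ge0 ?exprn_ge0// invr_ge0 exprn_ge0.
apply: eq_bigl => A; apply: andb_idl => AX; exact: subset_trans XY.
Qed.

(** Pair each [A] avoiding [e] with [e |: A]. Since [e] removes at most one component, the second
    term is at most [q * w] times the first, and [1 + q * w <= q * (1 + w)]. *)
Lemma fk_sum_setD1 w q X e : 0 <= w -> (0 < q)%N ->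
  fk_sum w q X <= q%:R * (1 + w) * fk_sum w q (X :\ e).
Proof.
move=> w0 q0; have q1 : 1 <= q%:R :> R by rewrite ler1n.
have qw : 1 + q%:R * w <= q%:R * (1 + w) :> R by lra.
have q0' : 0 < q%:R :> R by rewrite ltr0n.
have [eX|eX] := boolP (e \in X); last first.
  have -> : X :\ e = X by apply/setP => a; rewrite !inE; case: eqP eX => // -> /negPf->.
  rewrite ler_peMl ?fk_sum_ge0// mulr_ege1//; lra.
rewrite {1}/fk_sum (sum_subset_setD1 _ _ e)//.
apply: (le_trans _ (ler_wpM2r (fk_sum_ge0 _ _ _ w0) qw)).
rewrite /fk_sum mulr_sumr; apply: ler_sum => A; rewrite subsetD1 => /andP[_ eA].
rewrite cardsU1 eA /= add1n exprS mulrDl mul1r lerD2l -!mulrA [leRHS]mulrCA.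
rewrite ler_wpM2l// [leRHS]mulrCA ler_wpM2l ?exprn_ge0//.
rewrite ler_pdivlMr ?exprn_gt0// mulrC ler_pdivrMr ?exprn_gt0// -exprS.
by rewrite ler_weXn2l// ncomp_setU1.
Qed.

Lemma fk_sum_setD w q X Y : 0 <= w -> (0 < q)%N ->
  fk_sum w q X <= (q%:R * (1 + w)) ^+ #|Y| * fk_sum w q (X :\: Y).
Proof.
move=> w0 q0; elim: {Y}#|Y| {-2}Y (erefl #|Y|) => [|m IHm] Y cY.
  by rewrite (cards0_eq cY) cards0 setD0 mul1r.
have [e eY] : exists e, e \in Y by apply/set0Pn; rewrite -card_gt0 cY.
have cYe : #|Y :\ e| = m by move: cY; rewrite (cardsD1 e) eY => -[].
rewrite (le_trans (IHm _ cYe))// cYe cY exprSr -mulrA ler_wpM2l//.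
  by rewrite exprn_ge0// mulr_ge0// addr_ge0.
rewrite -{2}(setD1K eY) setUC -setDDl; exact: fk_sum_setD1.
Qed.

End Components.

(** * The heat-bath and Swendsen--Wang kernels *)

Section Dynamics.
Context {R : realType} {V E : finType} (ends : E -> V * V) (q : nat) (beta : R).
Implicit Types (s t : config V q) (v : V).

Local Notation pi := (Defs.piP ends q beta).
Local Notation SW := (P_SW ends q beta).
Local Notation HB := (P_HB ends q beta).

Lemma Zpotts_gt0 s : 0 < Zpotts ends q beta.
Proof.
rewrite /Zpotts (bigD1 s)//= ltr_pwDl ?expR_gt0//.
by apply: sumr_ge0 => t _; apply: expR_ge0.
Qed.

Lemma piP_gt0 s : 0 < pi s.
Proof. by rewrite divr_gt0 ?expR_gt0// (Zpotts_gt0 s). Qed.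

Lemma in_fiberP s v t :
  reflect (forall u, u != v -> t u = s u) (in_fiber s v t).
Proof.
apply: (iffP forallP) => [H u uv|H u].
  by have := H u; rewrite uv => /eqP.
by apply/implyP => uv; apply/eqP/H.
Qed.

Lemma in_fiberE s v t : in_fiber s v t = (t == recolor s v (t v)).
Proof.
apply/in_fiberP/eqP => [H|-> u /negPf uv]; last by rewrite ffunE uv.
by apply/ffunP => u; rewrite ffunE; case: eqVneq => [->|/H].
Qed.

Lemma in_fiber_sym s v t : in_fiber s v t = in_fiber t v s.
Proof. by apply/in_fiberP/in_fiberP => H u uv; rewrite H. Qed.

Lemma recolor_in_fiber s v k : in_fiber s v (recolor s v k).
Proof. by apply/in_fiberP => u /negPf uv; rewrite ffunE uv. Qed.

Lemma recolor_fiber s v t : in_fiber s v t -> recolor t v = recolor s v.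
Proof.
move=> /in_fiberP st; apply/funext => k; apply/ffunP => u; rewrite !ffunE.
by case: eqVneq => // /st.
Qed.

Lemma sum_in_fiber s v (f : config V q -> R) :
  \sum_t f t * (in_fiber s v t)%:R = \sum_k f (recolor s v k).
Proof.
under eq_bigr do rewrite mulr_natr mulrb.
rewrite -big_mkcond /= (reindex_onto (recolor s v) (fun t => t v)) /=.
  apply: eq_bigl => k; rewrite recolor_in_fiber ffunE eqxx; exact: eqxx.
by move=> t; rewrite in_fiberE => /eqP <-.
Qed.

Lemma fiber_weight_gt0 s v : 0 < \sum_k pi (recolor s v k).
Proof.
rewrite (bigD1 (s v))//= ltr_pwDl ?piP_gt0//.
by apply: sumr_ge0 => k _; apply/ltW/piP_gt0.
Qed.

Lemma P_HB_ge0 s t : 0 <= HB s t.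
Proof.
rewrite mulr_ge0 ?invr_ge0//; apply: sumr_ge0 => v _.
by rewrite mulr_ge0// divr_ge0 ?(ltW (piP_gt0 _)) ?(ltW (fiber_weight_gt0 _ _)).
Qed.

Lemma P_HB_reversible s t : pi s * HB s t = pi t * HB t s.
Proof.
rewrite /P_HB mulrCA [RHS]mulrCA; congr (_ * _); rewrite !mulr_sumr.
apply: eq_bigr => v _; rewrite in_fiber_sym.
have [st|_] := boolP (in_fiber t v s); last by rewrite !mulr0.
by rewrite (recolor_fiber t v s st) !mulr1; ring.
Qed.

Lemma P_HB_row_sum s : (0 < #|V|)%N -> \sum_t HB s t = 1.
Proof.
move=> V0; rewrite -mulr_sumr exchange_big /=.
rewrite (eq_bigr (fun _ => 1)) => [|v _].
  by rewrite sumr_const mulVf// pnatr_eq0 -lt0n.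
rewrite sum_in_fiber -mulr_suml divff// gt_eqF//; exact: fiber_weight_gt0.
Qed.

(** For each [v], only the [q] configurations in the fiber of [t] contribute, each with a
    conditional probability at most 1; then average over [v]. *)
Lemma P_HB_col_sum_le t : \sum_s HB s t <= q%:R.
Proof.
rewrite -mulr_sumr exchange_big /=.
apply: (@le_trans _ _ ((#|V|%:R)^-1 * \sum_(v : V) q%:R)).
  rewrite ler_wpM2l ?invr_ge0//; apply: ler_sum => v _.
  under eq_bigr do rewrite in_fiber_sym.
  rewrite (sum_in_fiber t v (fun s => pi t / \sum_l pi (recolor s v l))).
  rewrite (eq_bigr (fun _ => pi t / \sum_l pi (recolor t v l))) => [|k _].
    rewrite sumr_const card_ord -[leLHS]mulr_natl ler_piMr//.
    rewrite ler_pdivrMr ?fiber_weight_gt0// mul1r.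
    have tE : t = recolor t v (t v) by apply/eqP; rewrite -in_fiberE; apply/in_fiberP.
    rewrite {1}tE (bigD1 (t v))//= lerDl; apply: sumr_ge0 => k _.
    exact/ltW/piP_gt0.
  by rewrite (recolor_fiber t v _ (recolor_in_fiber t v k)).
rewrite sumr_const -[_ *+ #|_|]mulr_natl mulrA.
have [->|V0] := eqVneq #|V| 0%N; first by rewrite mulr0 mul0r.
by rewrite mulVf ?mul1r// pnatr_eq0.
Qed.

Lemma P_HB_neq0_in_fiber s t : HB s t != 0 -> exists v, in_fiber s v t.
Proof.
apply: contraNP => /forallNP no; apply/eqP; rewrite /P_HB big1 ?mulr0// => v _.
by have /negP/negPf -> := no v; rewrite mulr0.
Qed.

Lemma P_HB_recolor_gt0 s v k : 0 < HB s (recolor s v k).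
Proof.
rewrite mulr_gt0 ?invr_gt0 ?ltr0n//; first by apply/card_gt0P; exists v.
rewrite (bigD1 v)//= ltr_pwDl//.
  by rewrite recolor_in_fiber mulr1 divr_gt0 ?piP_gt0 ?fiber_weight_gt0.
apply: sumr_ge0 => u _.
by rewrite mulr_ge0// divr_ge0 ?(ltW (piP_gt0 _)) ?(ltW (fiber_weight_gt0 _ _)).
Qed.

(** Recolor the vertices where [s] and [t] differ one by one, by induction on their number. *)
Lemma P_HB_connected s t : connect (fun s t => 0 < HB s t) s t.
Proof.
have [m] := ubnP #|[set v | s v != t v]|; elim: m s => // m IHm s.
have [/eqP|] := eqVneq [set v | s v != t v] set0.
  rewrite -subset0 => /subsetP same _; suff -> : s = t by rewrite connect0.
  apply/ffunP => v; apply/eqP; have := same v; rewrite !inE.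
  by case: eqP => // _ /(_ isT).
case/set0Pn => v; rewrite inE => stv.
rewrite (cardsD1 v) inE stv ltnS => le_m.
apply: connect_trans (connect1 (P_HB_recolor_gt0 s v (t v))) (IHm _ _).
apply: leq_ltn_trans le_m; apply/subset_leq_card/subsetP => u.
by rewrite !inE ffunE; case: (eqVneq u v) => [->|]; rewrite ?eqxx.
Qed.

Lemma compl_pSW : 1 - pSW beta = expR (- beta).
Proof. by rewrite /pSW subKr. Qed.

Local Notation w := (pSW beta / (1 - pSW beta)).

Lemma odds_pSW : 1 + w = expR beta.
Proof.
rewrite compl_pSW /pSW expRN invrK mulrBl mul1r mulVf ?gt_eqF ?expR_gt0//.
by rewrite addrC subrK.
Qed.

Lemma P_SWE s t :
  SW s t = expR (- beta) ^+ #|mono ends s| * fk_sum ends w q (mono ends s :&: mono ends t).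
Proof. by rewrite -compl_pSW. Qed.

(** The Gibbs weight of [s] cancels the power of [1 - p], leaving an expression symmetric in [s] and
    [t]. *)
Lemma piP_SW s t : pi s * SW s t =
  (Zpotts ends q beta)^-1 * fk_sum ends w q (mono ends s :&: mono ends t).
Proof.
rewrite P_SWE /Defs.piP -expRM_natr mulNr expRN.
by field; rewrite !gt_eqF ?expR_gt0 ?(Zpotts_gt0 s).
Qed.

Lemma P_SW_reversible s t : pi s * SW s t = pi t * SW t s.
Proof. by rewrite !piP_SW setIC. Qed.

Lemma sum_fk_sum (f : config V q -> config V q -> R) :
  \sum_s \sum_t fk_sum ends w q (mono ends s :&: mono ends t) * f s t =
  \sum_(A : {set E}) w ^+ #|A| * (q%:R ^+ ncomp ends A)^-1 *
    \sum_(s | A \subset mono ends s) \sum_(t | A \subset mono ends t) f s t.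
Proof.
under eq_bigr => s _ do under eq_bigr => t _ do
  rewrite mulr_suml big_mkcond /=.
under eq_bigr => s _ do rewrite exchange_big /=.
rewrite exchange_big /=; apply: eq_bigr => A _.
rewrite mulr_sumr [RHS]big_mkcond; apply: eq_bigr => s _ /=.
case: ifP => As; last by apply: big1 => t _; rewrite subsetI As.
rewrite mulr_sumr [RHS]big_mkcond; apply: eq_bigr => t _ /=.
by rewrite subsetI As.
Qed.

Hypothesis beta_ge0 : 0 <= beta.

Lemma odds_ge0 : 0 <= w.
Proof. by rewrite -(lerD2l 1) addr0 odds_pSW -expR0 ler_expR. Qed.

Lemma P_SW_ge0 s t : 0 <= SW s t.
Proof. by rewrite P_SWE mulr_ge0 ?exprn_ge0 ?expR_ge0// fk_sum_ge0 ?odds_ge0. Qed.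

(* The Swendsen-Wang kernel is a mixture over A of averages over the
   colorings constant on the components of A. *)
Lemma P_SW_psd (x : config V q -> R) : 0 <= \sum_s \sum_t pi s * SW s t * x s * x t.
Proof.
rewrite (eq_bigr (fun s => (Zpotts ends q beta)^-1 *
    \sum_t fk_sum ends w q (mono ends s :&: mono ends t) * (x s * x t))) => [|s _].
  rewrite -mulr_sumr sum_fk_sum.
  (* Positivity of the partition function is derived from a configuration; without one, all sums are
     empty. *)
  have [s _|no] := pickP (fun s : config V q => true); last first.
    rewrite big1 ?mulr0// => A _; rewrite big1 ?mulr0// => s.
    by have := no s.
  rewrite mulr_ge0 ?invr_ge0 ?(ltW (Zpotts_gt0 s))//; apply: sumr_ge0 => A _.
  rewrite mulr_ge0//.
    by rewrite mulr_ge0 ?exprn_ge0 ?odds_ge0// invr_ge0 exprn_ge0.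
  under eq_bigr => t _ do rewrite -mulr_sumr.
  by rewrite -mulr_suml -expr2 sqr_ge0.
rewrite mulr_sumr; apply: eq_bigr => t _.
by rewrite piP_SW !mulrA.
Qed.

(** For fixed [A], the number of compatible [t] cancels the power of [q]; the binomial theorem then
    gives [(1 + w) ^+ #|mono s|], the inverse of the prefactor. *)
Lemma P_SW_row_sum s : \sum_t SW s t = 1.
Proof.
under eq_bigr do rewrite P_SWE.
rewrite -mulr_sumr /fk_sum.
under eq_bigr do rewrite big_mkcond /=.
rewrite exchange_big /= (eq_bigr (fun A : {set E} =>
    if A \subset mono ends s then w ^+ #|A| else 0)) => [|A _].
  rewrite -big_mkcond sum_subset_exp odds_pSW -exprMn -expRD addNr expR0.
  by rewrite expr1n.
case: ifP => As; last by apply: big1 => t _; rewrite subsetI As.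
under eq_bigr do rewrite subsetI As /=.
rewrite -big_mkcond /= sumr_const -[LHS]mulr_natr -mulrA.
have -> : #|[pred t : config V q | A \subset mono ends t]| = (q ^ ncomp ends A)%N.
  by rewrite -card_monochromatic cardsE.
rewrite natrX mulVf ?mulr1// -natrX pnatr_eq0 -card_monochromatic -lt0n.
by apply/card_gt0P; exists s; rewrite inE.
Qed.

Definition incident v := [set e | ((ends e).1 == v) || ((ends e).2 == v)].

Lemma card_incident_le v : (#|incident v| <= maxdeg ends)%N.
Proof. exact: (leq_bigmax v). Qed.

Lemma mono_fiber s v t e : in_fiber s v t -> e \notin incident v ->
  (e \in mono ends t) = (e \in mono ends s).
Proof.
by move=> /in_fiberP st; rewrite !inE negb_or => /andP[e1 e2]; rewrite !st.
Qed.

Lemma P_SW_fiber_le s s' t t' v u : (0 < q)%N ->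
  in_fiber s v s' -> in_fiber t' u t ->
  SW s' t' <= (q%:R * expR (2 * beta)) ^+ (2 * maxdeg ends) * SW s t.
Proof.
move=> q0 ss' tt'; set D := maxdeg ends.
rewrite !P_SWE.
have eb1 : 1 <= expR beta by rewrite -expR0 ler_expR.
(* Only edges at [v] can be monochromatic in [s] but not in [s'], at most [D] of them. The weaker
   exponent [2 * D] matches that of [fk_le], so that the two factors merge into one power. *)
have mono_le : expR (- beta) ^+ #|mono ends s'| <=
    expR beta ^+ (2 * D) * expR (- beta) ^+ #|mono ends s|.
  have card_le : (#|mono ends s| <= #|mono ends s'| + 2 * D)%N.
    rewrite -(cardsID (incident v)) addnC leq_add//.
      apply/subset_leq_card/subsetP => e; rewrite inE => /andP[ev es].
      by rewrite (mono_fiber s v).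
    rewrite (leq_trans (subset_leq_card (subsetIr _ _)))//.
    by rewrite (leq_trans (card_incident_le v))// leq_pmull.
  rewrite expRN !exprVn -(ler_pM2r (_ : 0 < expR beta ^+ #|mono ends s'|)).
    rewrite mulVf ?expf_neq0 ?gt_eqF ?expR_gt0// mulrAC -exprD.
    by rewrite -(@mulfV _ (expR beta ^+ #|mono ends s|)) ?expf_neq0 ?gt_eqF ?expR_gt0//
      ler_wpM2r ?invr_ge0 ?exprn_ge0 ?expR_ge0// ler_weXn2l// addnC.
  by rewrite exprn_gt0 ?expR_gt0.
(* Delete the edges at [v] or [u], at most [2 * D]; the remaining common monochromatic edges are
   also monochromatic in [s] and [t]. *)
have fk_le : fk_sum ends w q (mono ends s' :&: mono ends t') <=
    (q%:R * expR beta) ^+ (2 * D) * fk_sum ends w q (mono ends s :&: mono ends t).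
  apply: (le_trans (fk_sum_setD _ _ _ _ (incident v :|: incident u) odds_ge0 q0)).
  rewrite odds_pSW; apply: ler_pM.
  - by rewrite exprn_ge0// mulr_ge0// expR_ge0.
  - by rewrite fk_sum_ge0// odds_ge0.
  - rewrite ler_weXn2l ?mulr_ege1 ?ler1n//.
    rewrite cardsU (leq_trans (leq_subr _ _))// mul2n -addnn.
    by rewrite leq_add ?card_incident_le.
  apply: fk_sum_subset; first exact: odds_ge0.
  apply/subsetP => e; rewrite !in_setD !in_setI in_setU negb_or.
  case/andP=> /andP[ev eu] /andP[es' et'].
  by rewrite -(mono_fiber _ _ _ _ ss' ev) (mono_fiber _ _ _ _ tt' eu) es'.
apply: (le_trans (ler_pM _ _ mono_le fk_le)).
- by rewrite exprn_ge0 ?expR_ge0.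
- by rewrite fk_sum_ge0// odds_ge0.
have -> : expR (2 * beta) = expR beta * expR beta by rewrite -expRD mulr2n mulrDl mul1r.
by rewrite mulrACA -exprMn [q%:R * (_ * _)]mulrCA lexx.
Qed.

(** Wherever both heat-bath factors are nonzero, the middle entry is at most [K * SW s t]. Pulling
    this out leaves a row sum of [HB], equal to 1, times a column sum, at most [q]. *)
Lemma P_HB_SW_HB_le s t : (0 < q)%N -> (0 < #|V|)%N ->
  c_SW (maxdeg ends) beta q * \sum_t' (\sum_s' HB s s' * SW s' t') * HB t' t
    <= SW s t.
Proof.
move=> q0 V0; rewrite /c_SW; set K := (q%:R * _) ^+ _.
have K0 : 0 < K by rewrite exprn_gt0// mulr_gt0 ?ltr0n ?expR_gt0.
rewrite -invfM ler_pdivrMl ?mulr_gt0 ?ltr0n//.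
apply: (@le_trans _ _ (\sum_t' (\sum_s' HB s s' * (K * SW s t)) * HB t' t)).
  apply: ler_sum => t' _; rewrite !mulr_suml; apply: ler_sum => s' _.
  have [->|/P_HB_neq0_in_fiber[v ss']] := eqVneq (HB s s') 0; first by rewrite !mul0r.
  have [->|/P_HB_neq0_in_fiber[u t't]] := eqVneq (HB t' t) 0; first by rewrite !mulr0.
  rewrite ler_wpM2r ?P_HB_ge0// ler_wpM2l ?P_HB_ge0//.
  exact: (P_SW_fiber_le s s' t t' v u).
rewrite -mulr_suml P_HB_row_sum// mul1r -mulr_sumr mulrC -mulrA.
by rewrite ler_wpM2r ?P_HB_col_sum_le// mulr_ge0 ?(ltW K0)// P_SW_ge0.
Qed.

(** For [q = 0] the constant is 0, the inverse of zero being zero; otherwise it is the inverse of a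
    product of factors at least 1. *)
Lemma c_SW_bounds D : 0 <= c_SW D beta q <= 1.
Proof.
case: (posnP q) => [->|q0]; first by rewrite /c_SW invr0 mul0r lexx ler01.
rewrite /c_SW mulr_ge0 ?invr_ge0 ?exprn_ge0 ?mulr_ge0 ?expR_ge0//=.
rewrite -invfM invf_le1 ?mulr_gt0 ?exprn_gt0 ?mulr_gt0 ?ltr0n ?expR_gt0//.
rewrite mulr_ege1 ?exprn_ege1 ?mulr_ege1 ?ler1n//.
by rewrite -[leLHS]expR0 ler_expR mulr_ge0.
Qed.

End Dynamics.

(** * Bounds for degenerate cases, and the comparison theorem *)

Lemma spectral_gap_le1 (R : realType) n (M : 'M[R]_n) : spectral_gap M <= 1.
Proof.
rewrite /spectral_gap gerBl; set S := (X in sup X).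
have [ubS|] := pselect (has_sup S); last by move=> /sup_out ->.
have [[b [a Ma ab]] hub] := ubS.
by apply: (le_trans (normr_ge0 a)); apply: ub_le_sup => //; exists a.
Qed.

(** No eigenvalue differs from 1, so the supremum is the default 0. *)
Lemma spectral_gap_id (R : realType) n : spectral_gap (1%:M : 'M[R]_n) = 1.
Proof.
rewrite /spectral_gap sup_out ?subr0// => -[[_ [a /andP[/eigenvalueP[v + vN0] a1] _]] _].
move: vN0 a1.
rewrite mulmx1 => /negPf vN0 /negPf a1 /eqP.
rewrite -subr_eq0 -{1}[v]scale1r -scalerBl scaler_eq0.
by rewrite vN0 subr_eq0 eq_sym a1.
Qed.

Theorem theorem3p1 (R : realType) (V E : finType) (ends : E -> V * V)
  (q : nat) (beta : R) (hbeta : 0 <= beta) :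
  spectral_gap (kmx (P_SW ends q beta))
    >= c_SW (maxdeg ends) beta q * spectral_gap (kmx (P_HB ends q beta)).
Proof.
have sum_enum (f : config V q -> R) :
    \sum_(i < #|{: config V q}|) f (enum_val i) = \sum_s f s.
  by rewrite -(big_enum_val (A := {: config V q})).
have [/andP[q0 V0]|degenerate] := boolP ((0 < q)%N && (0 < #|V|)%N).
  apply: (reversible_spectral_gap_le _ _ (fun i => Defs.piP ends q beta (enum_val i))).
  - by move=> i; apply: piP_gt0.
  - by move=> i j; rewrite !mxE P_SW_reversible.
  - by move=> i j; rewrite !mxE P_HB_reversible.
  - move=> i; rewrite -(P_SW_row_sum ends q beta (enum_val i)) -sum_enum.
    by apply: eq_bigr => j _; rewrite mxE.
  - move=> i; rewrite -(P_HB_row_sum ends q beta (enum_val i))// -sum_enum.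
    by apply: eq_bigr => j _; rewrite mxE.
  - by move=> i j; rewrite mxE P_SW_ge0.
  - by move=> i j; rewrite mxE P_HB_ge0.
  (* A path of configurations is carried over to matrix indices by [enum_rank]. *)
  - move=> i j; have /connectP[p] := P_HB_connected ends q beta (enum_val i) (enum_val j).
    elim: p i => [|s p IHp] i /=; first by move=> _ /enum_val_inj ->.
    move=> /andP[is_gt0 sp] lastp; apply: (connect_trans (y := enum_rank s)).
      by apply: connect1; rewrite mxE enum_rankK.
    by apply: IHp; rewrite enum_rankK.
  - move=> x; have := P_SW_psd ends q beta hbeta (fun s => x (enum_rank s)).
    rewrite -sum_enum; congr (0 <= _); apply: eq_bigr => i _.
    rewrite -sum_enum; apply: eq_bigr => j _.
    by rewrite mxE !enum_valK.
  - exact: c_SW_bounds.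
  - move=> i j; rewrite [leRHS]mxE.
    rewrite (le_trans _ (P_HB_SW_HB_le ends q beta hbeta _ _ q0 V0))//.
    rewrite ler_wpM2l//; first by have /andP[] := c_SW_bounds q beta hbeta (maxdeg ends).
    rewrite -sum_enum mxE; apply: ler_sum => k _; rewrite !mxE -sum_enum.
    rewrite le_eqVlt; apply/orP; left; apply/eqP; congr (_ * _).
    by apply: eq_bigr => l _; rewrite !mxE.
(* If [q] or the vertex set is empty, there is at most one configuration, so the Swendsen--Wang
   matrix is the identity, with gap 1. *)
have config_eq (s t : config V q) : s = t.
  apply/ffunP => v; case/negP: degenerate; apply/andP; split.
    by case: (s v) => [k]; apply: leq_trans.
  by apply/card_gt0P; exists v.
have -> : kmx (P_SW ends q beta) = 1%:M.
  apply/matrixP => i j; rewrite !mxE (_ : i = j); last exact/enum_val_inj/config_eq.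
  rewrite eqxx -(P_SW_row_sum ends q beta (enum_val j)).
  by rewrite (big_pred1 (enum_val j)) => // s; rewrite (config_eq s (enum_val j)) /= eqxx.
rewrite spectral_gap_id; have /andP[c0 c1] := c_SW_bounds q beta hbeta (maxdeg ends).
have [g0|g0] := lerP 0 (spectral_gap (kmx (P_HB ends q beta))).
  by rewrite mulr_ile1// spectral_gap_le1.
by rewrite (le_trans _ ler01)// mulr_ge0_le0// ltW.
Qed.
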